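(* Let $X\subseteq\mathbb{R}^n$ be a polyhedron contained in an open set $\mathcal{O}$, let $b\in\mathbb{R}$, and let $c$, $\varphi_k,g_k$ ($k=1,\dots,K$), $\phi_\ell,h_\ell$ ($\ell=1,\dots,L$) be B-differentiable functions from $\mathcal{O}$ to $\mathbb{R}$. Consider the problem $$(\mathrm{P})\quad \operatorname*{minimize}_{x\in X}\ c(x)+\sum_{k=1}^K\varphi_k(x)\mathbf{1}_{(0,\infty)}(g_k(x))\quad\text{subject to}\quad \sum_{\ell=1}^L\phi_\ell(x)\mathbf{1}_{(0,\infty)}(h_\ell(x))\le b .$$ Let $c$ and each $\varphi_k$ be Lipschitz continuous on $X$ with Lipschitz constants $\mathrm{Lip}_c$ and $\mathrm{Lip}_\varphi$, respectively, and let $\lambda>\mathrm{Lip}_c+K\,\mathrm{Lip}_\varphi$. For each $k$ and $\ell$ let $\theta_k^{\varphi}$ and $\theta_\ell^{\phi}$ be p-approximations of $\mathbf{1}_{(0,\infty)}$ (conditions (A0)--(A3) in the context), and for $\delta>0$ define $$\widehat\Phi_\lambda(x,\delta)=c(x)+\sum_{k=1}^K\varphi_k(x)\,\theta_k^{\varphi}(g_k(x),\delta)+\lambda\max\Big(\sum_{\ell=1}^L\phi_\ell(x)\,\theta_\ell^{\phi}(h_\ell(x),\delta)-b,\ 0\Big).$$ Let $\{\delta_\nu\}$ be a sequence of positive scalars converging to zero and for each $\nu$ let $x^\nu\in X$ be a d-stationary point of $\widehat\Phi_\lambda(\bullet,\delta_\nu)$ on $X$, i.e. $\widehat\Phi_\lambda(\bullet,\delta_\nu)'(x^\nu;v)\ge0$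 for all $v\in\mathcal{T}(X;x^\nu)$. Suppose $\lim_{\nu\to\infty}x^\nu=x^*$. Assume: (C1) there is an open neighborhood $\mathcal{N}_*$ of $x^*$ such that the functions $\varphi_k$, $k\in\mathcal{K}_=(x^* )$, and $\phi_\ell$, $\ell\in\mathcal{L}_=(x^* )$, are nonnegative on $X\cap\mathcal{N}_*$; (C2) for every $v\in\mathcal{T}(X;x^* )$: if $g_k'(x^*;v)\le0$ for all $k\in\mathcal{K}_=(x^* )$, then $g_k'(x;v)\le0$ for all $k\in\mathcal{K}_=(x^* )$ and all $x\in\mathcal{N}_*$; and if $h_\ell'(x^*;v)\le0$ for all $\ell\in\mathcal{L}_=(x^* )$, then $h_\ell'(x;v)\le0$ for all $\ell\in\mathcal{L}_=(x^* )$ and all $x\in\mathcal{N}_*$; (C3) $\lim_{\nu\to\infty}\theta_k^{\varphi}(g_k(x^\nu),\delta_\nu)=0$ for all $k\in\mathcal{K}_=(x^* )$ and $\lim_{\nu\to\infty}\theta_\ell^{\phi}(h_\ell(x^\nu),\delta_\nu)=0$ for all $\ell\in\mathcal{L}_=(x^* )$; (C4) for any $x\in X$ such that $\sum_{\ell\in\mathcal{L}_>(x)}\phi_\ell(x)>b$, there exists $\bar v\in\mathcal{T}(\widehat S_{\rm ps}(x);x)$ of unit length satisfying $\sum_{\ell\in\mathcal{L}_>(x)}\phi_\ell'(x;\bar v)\le-1$; (C5) the functions $c$, $\varphi_k$ for $k\in\mathcal{K}_>(x^* )$, and $\phi_\ell$ for $\ell\in\mathcal{L}_>(x^* )$ are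 Clarke regular at $x^*$. Then $x^*$ is a pseudo B-stationary solution of (P).
   Context: $\mathbf{1}_{(0,\infty)}(s)=1$ if $s>0$ and $0$ otherwise. A function $\psi:\mathcal{O}\to\mathbb{R}$ is B-differentiable if at every point it is locally Lipschitz continuous and the one-sided directional derivative $\psi'(x;v)=\lim_{\tau\downarrow0}(\psi(x+\tau v)-\psi(x))/\tau$ exists for all $v$. The tangent cone of a closed set $\widehat X$ at $\bar x\in\widehat X$ is $\mathcal{T}(\widehat X;\bar x)=\{v:\exists\,x^\nu\in\widehat X,\ x^\nu\to\bar x,\ \tau_\nu\downarrow0,\ v=\lim_\nu (x^\nu-\bar x)/\tau_\nu\}$. A point $\bar x\in\widehat X$ is B-stationary for minimizing a B-differentiable $\theta$ on the closed set $\widehat X$ if $\theta'(\bar x;v)\ge0$ for all $v\in\mathcal{T}(\widehat X;\bar x)$. Lengths and Lipschitz constants are Euclidean; $\mathrm{Lip}_\varphi$ is a common Lipschitz constant for all $\varphi_k$. A B-differentiable function $f$ is Clarke regular at $\bar x$ if for all sequences $z^\nu\to\bar x$ and all $v\in\mathbb{R}^n$, $\limsup_{\nu\to\infty}f'(z^\nu;v)\le f'(\bar x;v)$. p-approximation: $\theta:\mathbb{R}\times\mathbb{R}_{++}\to[0,1]$ such that there are functions $\underline\theta,\overline\theta:\mathbb{R}_{++}\to\mathbb{R}_+$ with (A0) $\lim_{\delta\downarrow0}\underline\theta(\delta)=\lim_{\delta\downarrow0}\overline\theta(\delta)=0$; (A1) $\lim_{\delta\downarrow0}\theta(t,\delta)=\mathbf{1}_{(0,\infty)}(t)$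 for all $t\in\mathbb{R}$; (A2) for all $\delta>0$, $\theta(t,\delta)=0$ for $t\le-\underline\theta(\delta)$ and $\theta(t,\delta)=1$ for $t\ge\overline\theta(\delta)$; (A3) for all $\delta>0$, $\theta(\bullet,\delta)$ is B-differentiable on $[-\underline\theta(\delta),\overline\theta(\delta)]$ with $\theta(\bullet,\delta)'(t;1)\ge0\ge\theta(\bullet,\delta)'(t;-1)$ for all $t$ in this interval. For $x\in X$: $\mathcal{K}_>(x),\mathcal{K}_=(x),\mathcal{K}_\le(x)$ are the sets of $k\in\{1,\dots,K\}$ with $g_k(x)>0$, $=0$, $\le0$ respectively; $\mathcal{L}_>(x),\mathcal{L}_=(x),\mathcal{L}_\le(x)$ are the sets of $\ell\in\{1,\dots,L\}$ with $h_\ell(x)>0$, $=0$, $\le0$. For $\bar x\in X$, $$\widehat S_{\rm ps}(\bar x)=\{x\in X:\ g_k(x)\le0\ \forall k\in\mathcal{K}_\le(\bar x),\ g_k(x)\ge0\ \forall k\in\mathcal{K}_>(\bar x),\ h_\ell(x)\le0\ \forall\ell\in\mathcal{L}_\le(\bar x),\ h_\ell(x)\ge0\ \forall\ell\in\mathcal{L}_>(\bar x)\}$$ and $S_{\rm ps}(\bar x)=\{x\in\widehat S_{\rm ps}(\bar x):\sum_{\ell\in\mathcal{L}_>(\bar x)}\phi_\ell(x)\le b\}$. The vector $\bar x$ is a pseudo B-stationary solution of (P) if $\bar x\in S_{\rm ps}(\bar x)$ and $\bar x$ is a B-stationary point of minimizing $c(x)+\sum_{k\in\mathcal{K}_>(\bar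 x)}\varphi_k(x)$ over $x\in S_{\rm ps}(\bar x)$. *)

(* Defs.v *)
(* R^n is 'rV[R]_n, whose topology is the usual one.  The library norm on
   'rV[R]_n is the sup norm, so lengths and quantitative
   Lipschitz constants go through [enorm] below. *)
From mathcomp Require Import all_boot all_order all_algebra.
From mathcomp Require Import all_classical all_reals all_analysis.
Set Implicit Arguments.
Unset Strict Implicit.
Unset Printing Implicit Defensive.
Import Order.TTheory GRing.Theory Num.Theory.
Import numFieldNormedType.Exports.
Local Open Scope classical_set_scope.
Local Open Scope ring_scope.

Section directional.
Variables (R : realType) (V : normedModType R).
Implicit Types (f : V -> R) (x v : V) (A : set V).

Definition dir_quot f x v (t : R) : R := (f (x + t *: v) - f x) / t.

(* One-sided directional derivative f'(x; v).  Like every [lim], it is a junk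
   value when the limit does not exist. *)
Definition dirderiv f x v : R := lim (dir_quot f x v @ 0^'+).

Definition locally_lipschitz_at f x : Prop :=
  exists2 U : set V, nbhs x U & [lipschitz f y | y in U].

(* f is total, but for open A only its values on A matter. *)
Definition B_differentiable_on A f : Prop :=
  forall x, A x ->
    locally_lipschitz_at f x /\ forall v, cvg (dir_quot f x v @ 0^'+).

Definition tangent_cone A x : set V :=
  [set v | exists (y : nat -> V) (tau : nat -> R),
    [/\ forall nu, A (y nu),
        y @ \oo --> x,
        forall nu, 0 < tau nu,
        tau @ \oo --> (0 : R) &
        (fun nu => (tau nu)^-1 *: (y nu - x)) @ \oo --> v]].

Definition B_stationary f A x : Prop :=
  A x /\ forall v, tangent_cone A x v -> 0 <= dirderiv f x v.

Definition Clarke_regular f x : Prop :=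
  forall z : nat -> V, z @ \oo --> x ->
  forall v, (limn_esup (fun nu => (dirderiv f (z nu) v)%:E)
               <= (dirderiv f x v)%:E)%E.

End directional.

Section euclidean.
Variables (R : realType) (n : nat).

Definition enorm (x : 'rV[R]_n) : R := Num.sqrt (\sum_i x ord0 i ^+ 2).

Definition elipschitz_on (A : set 'rV[R]_n) (f : 'rV[R]_n -> R) (k : R) : Prop :=
  forall x y, A x -> A y -> `|f x - f y| <= k * enorm (x - y).

Definition polyhedron (A : set 'rV[R]_n) : Prop :=
  exists (m : nat) (M : 'M[R]_(n, m)) (d : 'rV[R]_m),
    A = [set x | forall i, (x *m M) ord0 i <= d ord0 i].

End euclidean.

(* p-approximation of the indicator of ]0, +oo[; [theta t delta] is only
   constrained for delta > 0.  B-differentiability on the closed interval is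
   that of [theta ^~ delta] as a function on the whole line, which agrees with
   the notion relative to the interval since [theta ^~ delta] is constant beyond
   each end point. *)
Definition p_approximation (R : realType) (theta : R -> R -> R) : Prop :=
  (forall t delta, 0 < delta -> 0 <= theta t delta <= 1) /\
  exists lo up : R -> R,
    [/\ forall delta, 0 < delta -> 0 <= lo delta /\ 0 <= up delta,
        lo @ 0^'+ --> (0 : R) /\ up @ 0^'+ --> (0 : R),
        forall t,
          theta t @ 0^'+ --> (\1_[set s : R | 0 < s] t : R),
        forall delta, 0 < delta -> forall t,
          (t <= - lo delta -> theta t delta = 0) /\
          (up delta <= t -> theta t delta = 1) &
        forall delta, 0 < delta ->
          B_differentiable_on [set` `[- lo delta, up delta]] (theta ^~ delta) /\
          forall t, t \in `[- lo delta, up delta] ->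
            dirderiv (theta ^~ delta) t (-1) <= 0 <=
              dirderiv (theta ^~ delta) t 1].

Section problem.
Variables (R : realType) (n K L : nat).
Implicit Types (x xbar : 'rV[R]_n).

Definition idx_pos m (f : 'I_m -> 'rV[R]_n -> R) x : pred 'I_m :=
  [pred i | 0 < f i x].
Definition idx_zero m (f : 'I_m -> 'rV[R]_n -> R) x : pred 'I_m :=
  [pred i | f i x == 0].
Definition idx_npos m (f : 'I_m -> 'rV[R]_n -> R) x : pred 'I_m :=
  [pred i | f i x <= 0].

(* Data of the problem
     minimize    c x + \sum_k vphi k x * 1_(0,oo)(g k x)   over x in X
     subject to  \sum_l phi l x * 1_(0,oo)(h l x) <= b. *)
Variables (X : set 'rV[R]_n) (b : R) (c : 'rV[R]_n -> R).
Variables (vphi g : 'I_K -> 'rV[R]_n -> R) (phi h : 'I_L -> 'rV[R]_n -> R).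

Definition S_ps_hat xbar : set 'rV[R]_n :=
  [set x | [/\ X x,
      forall k, k \in idx_npos g xbar -> g k x <= 0,
      forall k, k \in idx_pos g xbar -> 0 <= g k x,
      forall l, l \in idx_npos h xbar -> h l x <= 0 &
      forall l, l \in idx_pos h xbar -> 0 <= h l x]].

Definition S_ps xbar : set 'rV[R]_n :=
  [set x | S_ps_hat xbar x /\ \sum_(l in idx_pos h xbar) phi l x <= b].

Definition pseudo_B_stationary xbar : Prop :=
  B_stationary (fun x => c x + \sum_(k in idx_pos g xbar) vphi k x)
    (S_ps xbar) xbar.

Definition Phi_hat (theta_vphi : 'I_K -> R -> R -> R)
    (theta_phi : 'I_L -> R -> R -> R) (lambda : R) x (delta : R) : R :=
  c x + \sum_(k < K) vphi k x * theta_vphi k (g k x) delta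
  + lambda * Num.max (\sum_(l < L) phi l x * theta_phi l (h l x) delta - b) 0.

End problem.

(* Main.v *)
Require Import Defs.
From mathcomp Require Import all_boot all_order all_algebra.
From mathcomp Require Import all_classical all_reals all_analysis.
From mathcomp Require Import ring lra.
Set Implicit Arguments.
Unset Strict Implicit.
Unset Printing Implicit Defensive.
Import Order.TTheory GRing.Theory Num.Theory.
Import numFieldNormedType.Exports.
Local Open Scope classical_set_scope.
Local Open Scope ring_scope.

(* Fix v tangent to S_ps_hat(xstar) at xstar.  Since X is polyhedral, v is also
   tangent to X at x_nu for large nu, so d-stationarity applies to v.  In the
   directional derivative of Phi_hat at x_nu, an index whose g_k (or h_l) is
   nonzero at xstar contributes vphi_k'(x_nu; v) or 0, because the smoothed
   indicator is constant near x_nu.  An index with g_k(xstar) = 0 contributes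
   vphi_k'(x_nu; v) theta(g_k(x_nu)), which vanishes by (C3) and boundedness of
   vphi_k', plus vphi_k(x_nu) times a derivative of theta o g_k that is
   nonpositive by (A3) and (C2).  Passing to the limit with Clarke regularity,
   the vector of (C4) forces the limit constraint to hold as soon as
   lambda > Lip_c + K Lip_vphi, and stationarity then follows because the
   penalty term is asymptotically nonpositive along tangents to S_ps(xstar). *)

(** * One-sided directional derivatives *)

Lemma cvg_near_eq (T : Type) (U : nbhsType) (F : set_system T) {FF : Filter F}
    (f g : T -> U) (l : U) :
  f @ F --> l -> (\forall s \near F, f s = g s) -> g @ F --> l.
Proof.
move=> fl fg; apply: cvg_trans fl; apply: near_eq_cvg.
by apply: filterS fg => s ->.
Qed.

Section directional_calculus.
Variables (R : realType) (V : normedModType R).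
Implicit Types (f g : V -> R) (x v : V).

(** Relational form: it asserts that the limit exists, which an equation on [dirderiv] does not,
    since [dirderiv] takes a default value when the quotient diverges. *)
Definition has_dirderiv f x v (d : R) := dir_quot f x v @ 0^'+ --> d.

Lemma has_dirderivE f x v d : has_dirderiv f x v d -> dirderiv f x v = d.
Proof. exact: cvg_lim. Qed.

Lemma B_differentiable_has_dirderiv (A : set V) f x v :
  B_differentiable_on A f -> A x -> has_dirderiv f x v (dirderiv f x v).
Proof. by move=> fB /fB[_ /(_ v)]. Qed.

Lemma locally_lipschitz_atP f x : locally_lipschitz_at f x ->
  exists2 k, 0 < k & exists2 U, nbhs x U &
    forall y z, U y -> U z -> `|f y - f z| <= k * `|y - z|.
Proof.
move=> [U xU /pinfty_ex_gt0[k k0 fk]]; exists k => //; exists U => // y z Uy Uz.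
exact: (fk (y, z)).
Qed.

Lemma locally_lipschitz_at_sum (I : Type) (r : seq I) (P : pred I)
    (f : I -> V -> R) x :
  (forall i, P i -> locally_lipschitz_at (f i) x) ->
  locally_lipschitz_at (fun y => \sum_(i <- r | P i) f i y) x.
Proof.
move=> fL; have [k [U xU fk]] : exists k, exists2 U, nbhs x U &
    forall y z, U y -> U z -> `|\sum_(i <- r | P i) f i y -
      \sum_(i <- r | P i) f i z| <= k * `|y - z|.
  elim: r => [|i r [k [U xU fk]]].
    exists 0, setT; first exact: filterT.
    by move=> y z _ _; rewrite !big_nil subrr normr0 mul0r.
  have [Pi|nPi] := boolP (P i); last first.
    by exists k, U => // y z; rewrite !big_cons (negbTE nPi); exact: fk.
  have /locally_lipschitz_atP[k' _ [W xW fk']] := fL _ Pi.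
  exists (k' + k), (W `&` U); first exact: filterI.
  move=> y z [Wy Uy] [Wz Uz]; rewrite !big_cons Pi opprD addrACA mulrDl.
  by rewrite (le_trans (ler_normD _ _))// lerD// ?fk' ?fk.
exists U => //; have Ux := nbhs_singleton xU.
have PF : ProperFilter (globally (U `*` U)).
  exact: (globally_properfilter (a := (x, x))).
by apply: (klipschitzW (k := k)) => -[y z] [/= Uy Uz]; exact: fk.
Qed.

Lemma locally_lipschitz_at_continuous f x :
  locally_lipschitz_at f x -> {for x, continuous f}.
Proof.
move=> /locally_lipschitz_atP[k k0 [U xU fk]].
apply/cvgrPdist_lt => e e0; near=> y.
rewrite (le_lt_trans (fk _ _ _ _))//; first exact: nbhs_singleton.
  by near: y.
rewrite mulrC -ltr_pdivlMr//; near: y.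
by apply: cvgr_dist_lt => //; rewrite divr_gt0.
Unshelve. all: by end_near. Qed.

Lemma cvg_at_right_gt0 (T : Type) (F : set_system T) {FF : Filter F}
    (tau : T -> R) :
  (\forall s \near F, 0 < tau s) -> tau @ F --> (0 : R) -> tau @ F --> 0^'+.
Proof. by move=> tau0 tauc P /tauc; apply: filterS2 tau0 => s ? /=; apply. Qed.

(* Local Lipschitz continuity upgrades one-sided directional derivatives to
   derivatives along arbitrary curves tangent to [v] (Hadamard sense). *)
Lemma dirderiv_along (T : Type) (F : set_system T) {FF : ProperFilter F}
    f x v d (y : T -> V) (tau : T -> R) :
  locally_lipschitz_at f x -> has_dirderiv f x v d ->
  (\forall s \near F, 0 < tau s) -> tau @ F --> (0 : R) ->
  (fun s => (tau s)^-1 *: (y s - x)) @ F --> v ->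
  (fun s => (f (y s) - f x) / tau s) @ F --> d.
Proof.
move=> /locally_lipschitz_atP[k k0 [U xU fk]] fd tau0 tauc wv.
have tauv : (fun s => x + tau s *: v) @ F --> x.
  rewrite -[X in _ --> X]addr0 -(scale0r v).
  by apply: cvgD; [exact: cvg_cst|exact: cvgZr_tmp].
have yx : y @ F --> x.
  have : (fun s => x + tau s *: ((tau s)^-1 *: (y s - x))) @ F --> x.
    rewrite -[X in _ --> X]addr0 -(scale0r v).
    by apply: cvgD; [exact: cvg_cst|exact: cvgZ].
  move=> /cvg_near_eq; apply; apply: filterS tau0 => s s0.
  by rewrite scalerA mulfV ?gt_eqF// scale1r addrC subrK.
have q : (fun s => dir_quot f x v (tau s)) @ F --> d.
  exact: cvg_comp (cvg_at_right_gt0 tau0 tauc) fd.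
suff dif : (fun s => (f (y s) - f x) / tau s - dir_quot f x v (tau s)) @ F
    --> (0 : R).
  rewrite -[d]add0r; apply: (cvg_near_eq (cvgD dif q)).
  by apply: nearW => s /=; rewrite subrK.
apply/cvgrPdist_lt => e e0; near=> s.
have t0 : 0 < tau s by near: s.
rewrite sub0r normrN /dir_quot -mulrBl opprB addrA subrK.
rewrite normrM (gtr0_norm (_ : 0 < (tau s)^-1)) ?invr_gt0//.
(* The points [y s] and [x + tau s *: v] lie at distance [tau s] times the norm of
   [v - (tau s)^-1 *: (y s - x)]; dividing the Lipschitz bound by [tau s] leaves [k] times a
   vanishing quantity. *)
rewrite (@le_lt_trans _ _ (k * `|v - (tau s)^-1 *: (y s - x)|))//.
  rewrite ler_pdivrMr// (le_trans (fk _ _ _ _))//.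
  - by near: s; apply: yx.
  - by near: s; apply: tauv.
  rewrite -mulrA ler_wpM2l ?(ltW k0)// mulrC -[X in X * _]gtr0_norm//.
  rewrite -normrZ scalerBr scalerA mulfV ?gt_eqF// scale1r.
  by rewrite distrC opprB addrA (addrC x).
rewrite mulrC -ltr_pdivlMr//; near: s.
by apply: cvgr_dist_lt => //; rewrite divr_gt0.
Unshelve. all: by end_near. Qed.

Lemma has_dirderiv_cst (a : R) x v : has_dirderiv (fun=> a) x v 0.
Proof.
apply: cvg_near_cst; apply: nearW => t.
by rewrite /dir_quot subrr mul0r.
Qed.

Lemma has_dirderiv0 f x : has_dirderiv f x 0 0.
Proof.
apply: cvg_near_cst; apply: nearW => t.
by rewrite /dir_quot scaler0 addr0 subrr mul0r.
Qed.

Lemma has_dirderivD f g x v d e : has_dirderiv f x v d ->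
  has_dirderiv g x v e -> has_dirderiv (fun y => f y + g y) x v (d + e).
Proof.
move=> fd ge; apply: (cvg_near_eq (cvgD fd ge)).
apply: nearW => t.
by rewrite fctE /dir_quot; ring.
Qed.

Lemma has_dirderiv_sum (I : Type) (r : seq I) (P : pred I) (f : I -> V -> R)
    x v (d : I -> R) :
  (forall i, P i -> has_dirderiv (f i) x v (d i)) ->
  has_dirderiv (fun y => \sum_(i <- r | P i) f i y) x v
    (\sum_(i <- r | P i) d i).
Proof.
move=> fd; elim: r => [|i r ih].
  rewrite big_nil; under eq_fun do rewrite big_nil.
  exact: has_dirderiv_cst.
rewrite big_cons; under eq_fun do rewrite big_cons.
by case: ifPn => // Pi; apply: has_dirderivD => //; exact: fd.
Qed.

(** A convergent difference quotient multiplied by [t] tends to zero, so existence of the derivative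
    already gives continuity along the ray. *)
Lemma has_dirderiv_ray f x v d : has_dirderiv f x v d ->
  (fun t => f (x + t *: v)) @ 0^'+ --> f x.
Proof.
move=> fd.
have id0 : (fun t : R => t) @ 0^'+ --> (0 : R) by exact: cvg_within.
have h : (fun t => f x + t * dir_quot f x v t) @ 0^'+ --> f x.
  rewrite -[X in _ --> X](addr0 (f x)) -[X in _ --> _ + X](mul0r d).
  by apply: cvgD; [exact: cvg_cst|exact: cvgM].
apply: (cvg_near_eq h); near=> t.
have t0 : t != 0 by rewrite gt_eqF//; near: t; exact: nbhs_right_gt.
by rewrite /dir_quot mulrCA mulfV// mulr1 addrC subrK.
Unshelve. all: by end_near. Qed.

Lemma has_dirderivM f g x v d e : has_dirderiv f x v d ->
  has_dirderiv g x v e ->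
  has_dirderiv (fun y => f y * g y) x v (d * g x + f x * e).
Proof.
move=> fd ge.
have h : (fun t => dir_quot f x v t * g (x + t *: v) + f x * dir_quot g x v t)
    @ 0^'+ --> d * g x + f x * e.
  apply: cvgD; apply: cvgM => //; [exact: has_dirderiv_ray ge|exact: cvg_cst].
apply: (cvg_near_eq h); apply: nearW => t.
by rewrite /dir_quot; ring.
Qed.

Lemma near_has_dirderiv f g x v d :
  (\forall t \near 0^'+, f (x + t *: v) = g (x + t *: v)) -> f x = g x ->
  has_dirderiv f x v d -> has_dirderiv g x v d.
Proof.
move=> fg fgx /cvg_near_eq; apply; apply: filterS fg => t.
by rewrite /dir_quot fgx => ->.
Qed.

Lemma has_dirderiv_scale f x v (a d : R) : 0 < a ->
  has_dirderiv f x v d -> has_dirderiv f x (a *: v) (a * d).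
Proof.
move=> a0 fd.
have : (fun t => dir_quot f x v (a * t)) @ 0^'+ --> d.
  have at0 : (fun t => a * t) @ 0^'+ --> (0 : R).
    suff : (fun t => a * t) @ 0^'+ --> a * 0 by rewrite mulr0.
    by apply: cvgM; [exact: cvg_cst|exact: cvg_within].
  apply: (cvg_comp _ _ (cvg_at_right_gt0 _ at0) fd).
  by near=> t; rewrite mulr_gt0.
move=> fd'.
have h : (fun t => a * dir_quot f x v (a * t)) @ 0^'+ --> a * d.
  by apply: cvgM => //; exact: cvg_cst.
apply: (cvg_near_eq h); near=> t.
rewrite /dir_quot scalerA (mulrC t) invfM mulrCA.
by rewrite mulVKf ?gt_eqF.
Unshelve. all: by end_near. Qed.

(** If [f x] is nonzero, its sign persists along the ray and the maximum reduces to one of its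
    arguments. If [f x = 0], positive homogeneity moves the maximum inside the quotient, and
    continuity of the positive part gives the limit. *)
Lemma has_dirderiv_max0 f x v d : has_dirderiv f x v d ->
  has_dirderiv (fun y => Num.max (f y) 0) x v
    (if 0 < f x then d else if f x < 0 then 0 else Num.max d 0).
Proof.
move=> fd; have fr := has_dirderiv_ray fd.
case: ifPn => [fx0|]; [|rewrite -leNgt => fx0; case: ifPn => [fx0'|]].
- apply: near_has_dirderiv fd; last by rewrite max_l// ltW.
  near=> t; rewrite max_l//; near: t; apply: cvgr_ge fr _ _ => //.
- apply: near_has_dirderiv (has_dirderiv_cst 0 x v).
    near=> t; rewrite max_r//; near: t; exact: cvgr_le fr _ _.
  by rewrite max_r.
- rewrite -leNgt => fx1.
  have {fx0 fx1} fx : f x = 0 by apply/eqP; rewrite eq_le fx0.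
  have : (fun t => Num.max (dir_quot f x v t) 0) @ 0^'+ --> Num.max d 0.
    have /cvgrPdist_lt fd' := fd.
    apply/cvgrPdist_lt => e /fd'; apply: filterS => t.
    (* The positive part is 1-Lipschitz, checked by cases on the two signs. *)
    apply: le_lt_trans; rewrite ler_norml.
    have h1 := ler_norm (d - dir_quot f x v t).
    have h2 := ler_norm (- (d - dir_quot f x v t)); rewrite normrN in h2.
    by apply/andP; split; case: (leP d 0) => ?;
      case: (leP (dir_quot f x v t) 0) => ?; lra.
  move=> /cvg_near_eq; apply; near=> t.
  rewrite /dir_quot fx maxxx !subr0 maxr_pMl ?mul0r//.
  by rewrite invr_ge0.
Unshelve. all: by end_near. Qed.

End directional_calculus.

(** * Local bounds, tangent cones and Clarke regularity *)

Section local_estimates.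
Variables (R : realType) (V : normedModType R).
Implicit Types (f : V -> R) (x v : V) (A : set V).

Lemma cvg_ray x v : (fun t : R => x + t *: v) @ 0^'+ --> x.
Proof.
suff : (fun t : R => x + t *: v) @ 0^'+ --> x + 0 *: v by rewrite scale0r addr0.
by apply: cvgD; [exact: cvg_cst|apply: cvgZr_tmp; exact: cvg_within].
Qed.

(** The constant is uniform over base points near [x], so it bounds the derivatives at all late
    iterates at once. *)
Lemma locally_lipschitz_dirderiv_bound f x : locally_lipschitz_at f x ->
  exists2 k, 0 < k & \forall y \near x,
    forall v d, has_dirderiv f y v d -> `|d| <= k * `|v|.
Proof.
move=> /locally_lipschitz_atP[k k0 [U xU fk]]; exists k => //.
have : \forall y \near x, nbhs y U by exact: nbhs_interior.
apply: filterS => y yU v d fd.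
have fd' : (fun t => `|dir_quot f y v t|) @ 0^'+ --> `|d| by exact: cvg_norm.
apply: (cvgr_to_le fd'); near=> t.
have t0 : 0 < t by near: t; exact: nbhs_right_gt.
rewrite /dir_quot normrM (gtr0_norm (_ : 0 < t^-1)) ?invr_gt0//.
rewrite ler_pdivrMr// (le_trans (fk _ _ _ _))//.
- by near: t; exact: (cvg_ray v yU).
- exact: nbhs_singleton.
- by rewrite addrAC subrr add0r normrZ gtr0_norm// mulrAC mulrA.
Unshelve. all: by end_near. Qed.

Lemma tangent_cone_sub A B x : A `<=` B ->
  tangent_cone A x `<=` tangent_cone B x.
Proof.
by move=> AB v [y [tau [Ay *]]]; exists y, tau; split=> // nu; exact/AB/Ay.
Qed.

Lemma tangent_cone_ray A x v :
  (\forall t \near 0^'+, A (x + t *: v)) -> tangent_cone A x v.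
Proof.
(* The factor [e / 2] keeps every step, including the first, strictly inside the radius [e]. *)
move=> [e /= e0 eA]; pose tau nu : R := e / 2 * nu.+1%:R^-1.
have tau0 nu : 0 < tau nu by rewrite mulr_gt0 ?divr_gt0 ?invr_gt0.
have tauc : tau @ \oo --> (0 : R).
  suff : tau @ \oo --> e / 2 * 0 by rewrite mulr0.
  by apply: cvgM; [exact: cvg_cst|exact: cvg_harmonic].
exists (fun nu => x + tau nu *: v), tau; split => //.
- move=> nu; apply: eA => //=; rewrite sub0r normrN gtr0_norm//.
  rewrite /tau (@le_lt_trans _ _ (e / 2))//; last by lra.
  by rewrite ler_piMr ?divr_ge0 ?(ltW e0)// invf_le1// ler1n.
- have near_tau0 : \forall nu \near \oo, 0 < tau nu by exact: nearW.
  exact: (cvg_comp _ _ (cvg_at_right_gt0 near_tau0 tauc) (@cvg_ray x v)).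
- apply: cvg_near_cst; apply: nearW => nu.
  by rewrite addrAC subrr add0r scalerA mulVf ?gt_eqF// scale1r.
Qed.

(** All quotients along the tangent sequence are nonpositive because [x] maximizes [f] on [A], and
    by [dirderiv_along] they converge to [d]. *)
Lemma tangent_cone_dirderiv_le0 A f x v d : tangent_cone A x v ->
  locally_lipschitz_at f x -> has_dirderiv f x v d ->
  (forall y, A y -> f y <= f x) -> d <= 0.
Proof.
move=> [y [tau [Ay _ tau0 tauc wv]]] fl fd fA.
have near_tau0 : \forall nu \near \oo, 0 < tau nu by exact: nearW.
apply: (cvgr_to_le (dirderiv_along fl fd near_tau0 tauc wv)).
apply: nearW => nu.
by rewrite mulr_le0_ge0 ?subr_le0 ?invr_ge0 ?(ltW (tau0 nu))// fA.
Qed.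

(** The upper limit is an infimum of suprema over tails, so some tail has its supremum below the
    bound plus [e]. *)
Lemma Clarke_regular_near f x (z : nat -> V) v e : Clarke_regular f x ->
  z @ \oo --> x -> 0 < e ->
  \forall nu \near \oo, dirderiv f (z nu) v < dirderiv f x v + e.
Proof.
move=> fC zx e0; have := fC z zx v.
rewrite /limn_esup limf_esupE => le.
have : (ereal_inf [set ereal_sup
    [set (dirderiv f (z nu) v)%:E | nu in W] | W in \oo]
    < (dirderiv f x v + e)%:E)%E.
  by rewrite (le_lt_trans le)// lte_fin ltrDl.
move=> /ereal_inf_lt[_ [W oW <-] We]; apply: filterS oW => nu Wnu.
rewrite -lte_fin; apply: le_lt_trans We; apply: ereal_sup_ubound.
by exists nu.
Qed.

Lemma Clarke_regular_sum_near (I : finType) (P : pred I) (f : I -> V -> R) x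
    (z : nat -> V) v e :
  (forall i, P i -> Clarke_regular (f i) x) -> z @ \oo --> x -> 0 < e ->
  \forall nu \near \oo, \sum_(i | P i) dirderiv (f i) (z nu) v
    <= \sum_(i | P i) dirderiv (f i) x v + e.
Proof.
(* The tolerance is shared among the indices; the successor keeps the denominator positive when [I]
   is empty. *)
move=> fC zx e0; have em0 : 0 < e / #|I|.+1%:R by rewrite divr_gt0.
have : \forall nu \near \oo, forall i, P i ->
    dirderiv (f i) (z nu) v <= dirderiv (f i) x v + e / #|I|.+1%:R.
  apply: filter_forall => i; have [Pi|nPi] := boolP (P i); last exact: nearW.
  by apply: filterS (Clarke_regular_near v (fC _ Pi) zx em0) => nu /ltW.
apply: filterS => nu ih; rewrite (le_trans (ler_sum _ ih))// big_split /=.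
apply: lerD => //.
rewrite sumr_const -(mulr_natr (e / _)) -mulrA ler_piMr ?(ltW e0)//.
by rewrite mulrC ler_pdivrMr// mul1r ler_nat ltnW// ltnS max_card.
Qed.

End local_estimates.

(** * Euclidean Lipschitz bounds and polyhedra *)

Section euclidean_facts.
Variables (R : realType) (n : nat).
Implicit Types (A X : set 'rV[R]_n) (x y v : 'rV[R]_n).

Lemma enormZ (a : R) x : 0 <= a -> enorm (a *: x) = a * enorm x.
Proof.
move=> a0; rewrite /enorm; under eq_bigr do rewrite mxE exprMn.
by rewrite -mulr_sumr sqrtrM ?sqr_ge0// sqrtr_sqr ger0_norm.
Qed.

Lemma enorm_gt0 x : x != 0 -> 0 < enorm x.
Proof.
move=> x0; rewrite sqrtr_gt0 lt_neqAle eq_sym.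
rewrite sumr_ge0 ?andbT => [|i _]; last exact: sqr_ge0.
rewrite psumr_eq0 => [|i _]; last exact: sqr_ge0.
apply: contra x0 => /allP x0; apply/eqP/rowP => i; rewrite mxE.
apply/eqP; rewrite -(sqrf_eq0 (x ord0 i)).
by apply: (x0 i); rewrite mem_index_enum.
Qed.

(** Two distinct points are required: on a singleton every constant, even a negative one, is a
    Lipschitz constant. *)
Lemma elipschitz_ge0 A f k x y : elipschitz_on A f k ->
  A x -> A y -> x != y -> 0 <= k.
Proof.
move=> fk Ax Ay xy; have := le_trans (normr_ge0 _) (fk _ _ Ax Ay).
by rewrite pmulr_lge0// enorm_gt0// subr_eq0.
Qed.

(** The Lipschitz estimate is available only between points of [A], so the ray must start inside
    [A]; for polyhedra [polyhedron_ray] supplies this. *)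
Lemma elipschitz_dirderiv_le A f k x v d : elipschitz_on A f k -> A x ->
  (\forall t \near 0^'+, A (x + t *: v)) -> has_dirderiv f x v d ->
  d <= k * enorm v.
Proof.
move=> fk Ax Av fd; apply: (cvgr_to_le fd); near=> t.
have t0 : 0 < t by near: t; exact: nbhs_right_gt.
rewrite ler_pdivrMr// (le_trans (ler_norm _))// (le_trans (fk _ _ _ Ax))//.
  by near: t.
by rewrite addrAC subrr add0r enormZ ?(ltW t0)// mulrCA mulrC.
Unshelve. all: by end_near. Qed.

Lemma mulmx_coord_continuous m (M : 'M[R]_(n, m)) i :
  continuous (fun x => (x *m M) ord0 i).
Proof.
have -> : (fun x : 'rV[R]_n => (x *m M) ord0 i) =
    (fun x => \sum_j x ord0 j * M j i) by apply/funext => x; rewrite mxE.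
move=> x; apply: (@cvg_big R _ +%R 0 xpredT _ _ (nbhs x)) => [|j _].
  exact: add_continuous.
by apply: cvgM; [exact: coord_continuous|exact: cvg_cst].
Qed.

Lemma polyhedron_cvg X (x : nat -> 'rV[R]_n) xstar : polyhedron X ->
  (forall nu, X (x nu)) -> x @ \oo --> xstar -> X xstar.
Proof.
move=> [m [M [d ->]]] xX xc i.
apply: (cvgr_to_le (cvg_comp _ _ xc (@mulmx_coord_continuous _ M i xstar))).
by apply: nearW => nu; exact: xX.
Qed.

(* A direction tangent to a polyhedron at [x] does not increase the constraints
   active at [x], and near [x] no other constraint is active. *)
Lemma polyhedron_ray X x v : polyhedron X -> tangent_cone X x v ->
  \forall y \near x, X y -> \forall t \near 0^'+, X (y + t *: v).
Proof.
move=> [m [M [d ->]]] [z [tau [zX zx tau0 tauc zv]]].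
suff H i : \forall y \near x, (y *m M) ord0 i <= d ord0 i ->
    \forall t \near 0^'+, ((y + t *: v) *m M) ord0 i <= d ord0 i.
  have : \forall y \near x, forall i, (y *m M) ord0 i <= d ord0 i ->
    \forall t \near 0^'+, ((y + t *: v) *m M) ord0 i <= d ord0 i.
    by apply: (@filter_forall _ _ _ (nbhs x)) => i; exact: H.
  apply: filterS => y yH yX; apply: filter_forall => i; exact/yH/yX.
have Mc := @mulmx_coord_continuous _ M i.
have [xd|dx] := ltP ((x *m M) ord0 i) (d ord0 i).
  have : \forall y \near x, (y *m M) ord0 i < d ord0 i.
    exact: (cvgr_lt _ (Mc x) _ xd).
  apply: filterS => y yd _.
  have : \forall t \near 0^'+, ((y + t *: v) *m M) ord0 i < d ord0 i.
    exact: (cvgr_lt _ (cvg_comp _ _ (@cvg_ray _ _ y v) (Mc y)) _ yd).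
  by apply: filterS => t /ltW.
have v0 : (v *m M) ord0 i <= 0.
  apply: (cvgr_to_le (cvg_comp _ _ zv (Mc v))); apply: nearW => nu /=.
  rewrite -scalemxAl mulmxBl mxE mulr_ge0_le0 ?invr_ge0 ?(ltW (tau0 nu))//.
  by rewrite mxE [X in _ + X]mxE subr_le0 (le_trans (zX nu i)).
near=> y; move=> yd; near=> t.
have t0 : 0 < t by near: t; exact: nbhs_right_gt.
rewrite mulmxDl -scalemxAl [leLHS]mxE [X in _ + X]mxE.
by rewrite -[leRHS]addr0 lerD// mulr_ge0_le0// ltW.
Unshelve. all: by end_near. Qed.

End euclidean_facts.

(** * Products with smoothed indicators *)

Section smoothed_indicators.
Variables (R : realType) (V : normedModType R).
Implicit Types (u w : V -> R) (theta : R -> R -> R).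

(** Strictly outside the transition interval, [theta] is constant around [w x] and the derivative is
    zero. Inside, a chain rule applies: a negative speed [s] yields [- s] times the derivative of
    [theta] in direction -1, which is nonpositive by (A3). *)
Lemma p_approximation_comp_le0 theta (delta : R) w x v s :
  p_approximation theta -> 0 < delta -> has_dirderiv w x v s -> s <= 0 ->
  exists2 e, e <= 0 & has_dirderiv (fun y => theta (w y) delta) x v e.
Proof.
move=> [_ [lo [up [_ _ _ A2 A3]]]] delta0 ws s0.
have A2l t := (A2 delta delta0 t).1; have A2u t := (A2 delta delta0 t).2.
have wr := has_dirderiv_ray ws.
have [wlo|low] := ltP (w x) (- lo delta).
  exists 0 => //; apply: near_has_dirderiv (has_dirderiv_cst 0 x v).
    near=> t; rewrite A2l//; near: t; exact: (cvgr_le _ wr _ wlo).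
  by rewrite A2l// ltW.
have [upw|wup] := ltP (up delta) (w x).
  exists 0 => //; apply: near_has_dirderiv (has_dirderiv_cst 1 x v).
    near=> t; rewrite A2u//; near: t; exact: (cvgr_ge _ wr _ upw).
  by rewrite A2u// ltW.
have wI : w x \in `[- lo delta, up delta] by rewrite in_itv/= low wup.
have [thB /(_ _ wI)/andP[th0 _]] := A3 delta delta0.
have [thL _] := thB _ wI.
have id_gt0 : \forall t \near (0 : R)^'+, 0 < t by exact: nbhs_right_gt.
(* Chain rule: [dirderiv_along] is applied to the real curve [w (x + t *: v)], whose velocity at
   zero is [s]. *)
have along e : has_dirderiv (theta^~ delta) (w x : R) (s : R) e ->
    has_dirderiv (fun y => theta (w y) delta) x v e.
  move=> the; apply: (dirderiv_along thL the id_gt0); first exact: cvg_within.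
  by apply: (cvg_near_eq ws); apply: nearW => t; rewrite /dir_quot mulrC.
have [s1|s1] := eqVneq s 0.
  by exists 0 => //; apply: along; rewrite s1; exact: has_dirderiv0.
exists (- s * dirderiv (theta^~ delta) (w x) (-1)).
  by rewrite mulr_ge0_le0// oppr_ge0.
have ns0 : 0 < - s by rewrite oppr_gt0 lt_neqAle s1.
have thd : has_dirderiv (theta^~ delta) (w x : R) (-1 : R)
    (dirderiv (theta^~ delta) (w x) (-1)).
  exact: B_differentiable_has_dirderiv thB wI.
have := has_dirderiv_scale ns0 thd.
by rewrite [_ *: _]mulrN mulr1 opprK; exact: along.
Unshelve. all: by end_near. Qed.

(** * Smoothed terms along a convergent sequence *)

Variables (O : set V) (delta : nat -> R) (x : nat -> V) (xstar v : V).
Hypotheses (O_open : open O) (O_xstar : O xstar).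
Hypotheses (delta_gt0 : forall nu, 0 < delta nu)
  (delta_cvg : delta @ \oo --> (0 : R)).
Hypothesis x_cvg : x @ \oo --> xstar.

Let delta_right : delta @ \oo --> 0^'+.
Proof. by apply: cvg_at_right_gt0 => //; exact: nearW. Qed.

Let x_O : \forall nu \near \oo, O (x nu).
Proof. by apply: x_cvg; exact: open_nbhs_nbhs. Qed.

Lemma B_differentiable_cvg u : B_differentiable_on O u ->
  (fun nu => u (x nu)) @ \oo --> u xstar.
Proof.
move=> uB; have [uL _] := uB _ O_xstar.
exact: (cvg_comp _ _ x_cvg (locally_lipschitz_at_continuous uL)).
Qed.

(** Around [x nu], [w] stays beyond half of its nonzero limit value, while the thresholds of (A2)
    shrink to zero; the smoothed indicator is therefore locally constant. *)
Lemma p_approximation_near theta w : p_approximation theta ->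
  B_differentiable_on O w ->
  (0 < w xstar -> \forall nu \near \oo,
     (\forall y \near x nu, theta (w y) (delta nu) = 1)) /\
  (w xstar < 0 -> \forall nu \near \oo,
     (\forall y \near x nu, theta (w y) (delta nu) = 0)).
Proof.
move=> [_ [lo [up [_ [lo0 up0] _ A2 _]]]] wB.
have wc := B_differentiable_cvg wB.
have lod := cvg_comp _ _ delta_right lo0.
have upd := cvg_comp _ _ delta_right up0.
split => w0; near=> nu; have xO : O (x nu) by near: nu.
- have near_w : \forall y \near x nu, w xstar / 2 < w y.
    have [wL _] := wB _ xO.
    apply: (cvgr_gt _ (locally_lipschitz_at_continuous wL)).
    by near: nu; apply: (cvgr_gt _ wc); lra.
  apply: filterS near_w => y wy; have [_ ->//] := A2 _ (delta_gt0 nu) (w y).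
  apply: ltW; apply: le_lt_trans wy; near: nu.
  by apply: (cvgr_le _ upd); lra.
- have near_w : \forall y \near x nu, w y < w xstar / 2.
    have [wL _] := wB _ xO.
    apply: (cvgr_lt _ (locally_lipschitz_at_continuous wL)).
    by near: nu; apply: (cvgr_lt _ wc); lra.
  apply: filterS near_w => y wy; have [->//] := A2 _ (delta_gt0 nu) (w y).
  apply: ltW; apply: (lt_le_trans wy); rewrite lerNr; near: nu.
  by apply: (cvgr_le _ lod); lra.
Unshelve. all: by end_near. Qed.

(* What (C1), (C2) and (C3) provide for an index whose threshold function [w]
   vanishes at the limit point. *)
Definition vanishing u w theta : Prop := w xstar = 0 ->
  [/\ \forall nu \near \oo, 0 <= u (x nu),
      \forall nu \near \oo, dirderiv w (x nu) v <= 0 &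
      (fun nu => theta (w (x nu)) (delta nu)) @ \oo --> (0 : R)].

Lemma smoothed_term_cvg theta u w : p_approximation theta ->
  B_differentiable_on O u -> B_differentiable_on O w -> vanishing u w theta ->
  (fun nu => u (x nu) * theta (w (x nu)) (delta nu)) @ \oo -->
    (if 0 < w xstar then u xstar else 0).
Proof.
move=> thA uB wB w0.
have [th1 th0] := p_approximation_near thA wB.
have uc := B_differentiable_cvg uB.
case: ltgtP => [/th1 {}th1|/th0 {}th0|/esym/w0[_ _ thc]].
- apply: (cvg_near_eq uc); move: th1; apply: filterS => nu /nbhs_singleton ->.
  by rewrite mulr1.
- apply: cvg_near_cst; move: th0; apply: filterS => nu /nbhs_singleton ->.
  by rewrite mulr0.
- by rewrite -(mulr0 (u xstar)); exact: cvgM.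
Qed.

Lemma smoothed_term_dirderiv theta u w e : p_approximation theta ->
  B_differentiable_on O u -> B_differentiable_on O w -> vanishing u w theta ->
  0 < e ->
  \forall nu \near \oo,
    let d := dirderiv (fun y => u y * theta (w y) (delta nu)) (x nu) v in
    has_dirderiv (fun y => u y * theta (w y) (delta nu)) (x nu) v d /\
    d <= (if 0 < w xstar then dirderiv u (x nu) v else 0) + e.
Proof.
move=> thA uB wB w0 e0.
have [th1 th0] := p_approximation_near thA wB.
suff : \forall nu \near \oo, exists2 d,
    has_dirderiv (fun y => u y * theta (w y) (delta nu)) (x nu) v d &
    d <= (if 0 < w xstar then dirderiv u (x nu) v else 0) + e.
  by apply: filterS => nu [d dH de] /=; rewrite (has_dirderivE dH).
have near_u : \forall nu \near \oo,
    has_dirderiv u (x nu) v (dirderiv u (x nu) v).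
  by apply: filterS x_O => nu; exact: B_differentiable_has_dirderiv.
case: ltgtP => [/th1 {}th1|/th0 {}th0|/esym/w0[u0 dw0 thc]].
- near=> nu; exists (dirderiv u (x nu) v); last by rewrite lerDl ltW.
  have thnu : \forall y \near x nu, theta (w y) (delta nu) = 1 by near: nu.
  have ray : \forall t \near 0^'+, theta (w (x nu + t *: v)) (delta nu) = 1.
    exact: (@cvg_ray _ _ (x nu) v _ thnu).
  apply: (@near_has_dirderiv _ _ u).
  + by apply: filterS ray => t ->; rewrite mulr1.
  + by rewrite (nbhs_singleton thnu) mulr1.
  + by near: nu.
- near=> nu; exists 0; last by rewrite add0r ltW.
  have thnu : \forall y \near x nu, theta (w y) (delta nu) = 0 by near: nu.
  have ray : \forall t \near 0^'+, theta (w (x nu + t *: v)) (delta nu) = 0.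
    exact: (@cvg_ray _ _ (x nu) v _ thnu).
  apply: near_has_dirderiv (has_dirderiv_cst 0 (x nu) v).
    by apply: filterS ray => t ->; rewrite mulr0.
  by rewrite (nbhs_singleton thnu) mulr0.
- have [uL _] := uB _ O_xstar.
  have [k k0 ku] := locally_lipschitz_dirderiv_bound uL.
  (* The added 1 keeps the later divisor positive when [v = 0]. *)
  have kv0 : 0 < k * `|v| + 1 by rewrite ltr_wpDl// mulr_ge0// ltW.
  near=> nu; have xO : O (x nu) by near: nu.
  have dwx : dirderiv w (x nu) v <= 0 by near: nu.
  have [f f0 thf] := p_approximation_comp_le0 thA (delta_gt0 nu)
    (B_differentiable_has_dirderiv wB xO) dwx.
  have ud : has_dirderiv u (x nu) v (dirderiv u (x nu) v) by near: nu.
  exists (dirderiv u (x nu) v * theta (w (x nu)) (delta nu) + u (x nu) * f).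
    exact: has_dirderivM.
  rewrite add0r -[leRHS]addr0 lerD//; last by rewrite mulr_ge0_le0//; near: nu.
  rewrite (le_trans (ler_norm _))// normrM.
  rewrite (@le_trans _ _ ((k * `|v| + 1) * `|theta (w (x nu)) (delta nu)|))//.
    rewrite ler_wpM2r// (@le_trans _ _ (k * `|v|)) ?lerDl//.
    have kx : forall v d, has_dirderiv u (x nu) v d -> `|d| <= k * `|v|.
      by near: nu; exact: (x_cvg ku).
    exact: kx.
  rewrite mulrC -ler_pdivlMr//; near: nu.
  by apply: (cvgr_norm_le _ thc); rewrite normr0 divr_gt0.
Unshelve. all: by end_near. Qed.

Variables (m : nat) (theta : 'I_m -> R -> R -> R) (u w : 'I_m -> V -> R).
Hypotheses (thA : forall i, p_approximation (theta i))
  (uB : forall i, B_differentiable_on O (u i))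
  (wB : forall i, B_differentiable_on O (w i))
  (w0 : forall i, vanishing (u i) (w i) (theta i)).

Lemma smoothed_sum_cvg :
  (fun nu => \sum_i u i (x nu) * theta i (w i (x nu)) (delta nu)) @ \oo -->
    \sum_(i | 0 < w i xstar) u i xstar.
Proof.
rewrite big_mkcond; apply: (@cvg_big R _ +%R) => [|i _].
  exact: add_continuous.
exact: smoothed_term_cvg.
Qed.

Lemma smoothed_sum_dirderiv e : 0 < e ->
  \forall nu \near \oo, exists2 d,
    has_dirderiv
      (fun y => \sum_i u i y * theta i (w i y) (delta nu)) (x nu) v d &
    d <= \sum_(i | 0 < w i xstar) dirderiv (u i) (x nu) v + e.
Proof.
move=> e0; have em0 : 0 < e / m.+1%:R by rewrite divr_gt0.
pose T i nu y := u i y * theta i (w i y) (delta nu).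
have : \forall nu \near \oo, forall i,
    has_dirderiv (T i nu) (x nu) v (dirderiv (T i nu) (x nu) v) /\
    dirderiv (T i nu) (x nu) v <=
      (if 0 < w i xstar then dirderiv (u i) (x nu) v else 0) + e / m.+1%:R.
  apply: filter_forall => i.
  exact: (smoothed_term_dirderiv (thA i) (uB i) (wB i) (@w0 i) em0).
apply: filterS => nu ih; exists (\sum_i dirderiv (T i nu) (x nu) v).
  by apply: has_dirderiv_sum => i _; exact: (ih i).1.
rewrite [X in _ <= X + _]big_mkcond (@le_trans _ _ (\sum_(i < m)
  ((if 0 < w i xstar then dirderiv (u i) (x nu) v else 0) + e / m.+1%:R)))//.
  by apply: ler_sum => i _; exact: (ih i).2.
rewrite big_split /=; apply: lerD => //.
rewrite sumr_const card_ord -(mulr_natr (e / _)) -mulrA ler_piMr ?(ltW e0)//.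
by rewrite mulrC ler_pdivrMr// mul1r ler_nat.
Qed.

End smoothed_indicators.

(** * Limits of d-stationary points *)

(** An index with value zero at [x] belongs to the nonpositive group, so its constraint holds on the
    whole set and is active at [x]: [x] maximizes that function there. *)
Lemma S_ps_hat_tangent_le0 (R : realType) n K L (X : set 'rV[R]_n)
    (g : 'I_K -> 'rV[R]_n -> R) (h : 'I_L -> 'rV[R]_n -> R)
    (O : set 'rV[R]_n) (x v : 'rV[R]_n) :
  O x -> (forall k, B_differentiable_on O (g k)) ->
  (forall l, B_differentiable_on O (h l)) ->
  tangent_cone (S_ps_hat X g h x) x v ->
  [/\ tangent_cone X x v,
      forall k, k \in idx_zero g x -> dirderiv (g k) x v <= 0 &
      forall l, l \in idx_zero h x -> dirderiv (h l) x v <= 0].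
Proof.
move=> Ox gB hB Tv; split.
- by apply: tangent_cone_sub Tv => y [].
- move=> k; rewrite inE => /eqP gk0; have [gL _] := gB k _ Ox.
  apply: (tangent_cone_dirderiv_le0 Tv gL).
    exact: B_differentiable_has_dirderiv (gB k) Ox.
  by move=> y [_ gle _ _ _]; rewrite gk0 gle// inE gk0.
- move=> l; rewrite inE => /eqP hl0; have [hL _] := hB l _ Ox.
  apply: (tangent_cone_dirderiv_le0 Tv hL).
    exact: B_differentiable_has_dirderiv (hB l) Ox.
  by move=> y [_ _ _ hle _]; rewrite hl0 hle// inE hl0.
Qed.

Theorem theorem17 (R : realType) (n K L : nat)
  (O X : set 'rV[R]_n) (b : R) (c : 'rV[R]_n -> R)
  (vphi g : 'I_K -> 'rV[R]_n -> R) (phi h : 'I_L -> 'rV[R]_n -> R)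
  (Lip_c Lip_vphi lambda : R)
  (theta_vphi : 'I_K -> R -> R -> R) (theta_phi : 'I_L -> R -> R -> R)
  (delta : nat -> R) (x : nat -> 'rV[R]_n) (xstar : 'rV[R]_n)
  (N : set 'rV[R]_n)
  (O_open : open O) (X_poly : polyhedron X) (XO : X `<=` O)
  (c_Bdiff : B_differentiable_on O c)
  (vphi_Bdiff : forall k, B_differentiable_on O (vphi k))
  (g_Bdiff : forall k, B_differentiable_on O (g k))
  (phi_Bdiff : forall l, B_differentiable_on O (phi l))
  (h_Bdiff : forall l, B_differentiable_on O (h l))
  (c_Lip : elipschitz_on X c Lip_c)
  (vphi_Lip : forall k, elipschitz_on X (vphi k) Lip_vphi)
  (lambda_gt : Lip_c + K%:R * Lip_vphi < lambda)
  (theta_vphi_approx : forall k, p_approximation (theta_vphi k))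
  (theta_phi_approx : forall l, p_approximation (theta_phi l))
  (delta_gt0 : forall nu, 0 < delta nu)
  (delta_cvg : delta @ \oo --> (0 : R))
  (x_X : forall nu, X (x nu))
  (x_dstat : forall nu v, tangent_cone X (x nu) v ->
    0 <= dirderiv
           (fun y => Phi_hat b c vphi g phi h theta_vphi theta_phi lambda
                       y (delta nu))
           (x nu) v)
  (x_cvg : x @ \oo --> xstar)
  (N_open : open N) (N_xstar : N xstar) (NO : N `<=` O)
  (C1 : (forall k, k \in idx_zero g xstar ->
           forall y, X y -> N y -> 0 <= vphi k y) /\
        (forall l, l \in idx_zero h xstar ->
           forall y, X y -> N y -> 0 <= phi l y))
  (C2 : forall v, tangent_cone X xstar v ->
    ((forall k, k \in idx_zero g xstar -> dirderiv (g k) xstar v <= 0) ->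
     forall k, k \in idx_zero g xstar ->
       forall y, N y -> dirderiv (g k) y v <= 0) /\
    ((forall l, l \in idx_zero h xstar -> dirderiv (h l) xstar v <= 0) ->
     forall l, l \in idx_zero h xstar ->
       forall y, N y -> dirderiv (h l) y v <= 0))
  (C3 : (forall k, k \in idx_zero g xstar ->
           (fun nu => theta_vphi k (g k (x nu)) (delta nu)) @ \oo
             --> (0 : R)) /\
        (forall l, l \in idx_zero h xstar ->
           (fun nu => theta_phi l (h l (x nu)) (delta nu)) @ \oo
             --> (0 : R)))
  (C4 : forall y, X y -> b < \sum_(l in idx_pos h y) phi l y ->
    exists vbar : 'rV[R]_n,
      [/\ tangent_cone (S_ps_hat X g h y) y vbar,
          enorm vbar = 1 &
          \sum_(l in idx_pos h y) dirderiv (phi l) y vbar <= -1])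
  (C5 : [/\ Clarke_regular c xstar,
            forall k, k \in idx_pos g xstar -> Clarke_regular (vphi k) xstar &
            forall l, l \in idx_pos h xstar -> Clarke_regular (phi l) xstar]) :
  pseudo_B_stationary X b c vphi g phi h xstar.
Proof.
have Xstar : X xstar := polyhedron_cvg X_poly x_X x_cvg.
have Ostar : O xstar := XO _ Xstar.
have hatstar : S_ps_hat X g h xstar xstar.
  by split=> // i; rewrite inE => // /ltW.
have near_N : \forall nu \near \oo, N (x nu).
  by apply: x_cvg; exact: open_nbhs_nbhs.
have penalty_cvg : (fun nu => \sum_l phi l (x nu) *
      theta_phi l (h l (x nu)) (delta nu)) @ \oo -->
    \sum_(l | 0 < h l xstar) phi l xstar.
  (* The limit of the values involves no direction, so direction 0 is chosen; the sign condition on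
     derivatives is then trivial. *)
  apply: (@smoothed_sum_cvg _ _ O delta x xstar 0) => // l hl0.
  have lz : l \in idx_zero h xstar by rewrite inE hl0.
  split; last exact: C3.2.
  - by apply: filterS near_N => nu; exact: C1.2.
  - apply: nearW => nu; rewrite (@has_dirderivE _ _ _ _ _ 0)//.
    exact: has_dirderiv0.
have near_ray v : tangent_cone X xstar v ->
    \forall nu \near \oo, \forall t \near 0^'+, X (x nu + t *: v).
  move=> Tv; have near_imp : \forall nu \near \oo,
      X (x nu) -> \forall t \near 0^'+, X (x nu + t *: v).
    exact: (x_cvg _ (polyhedron_ray X_poly Tv)).
  by move: near_imp; apply: filterS => nu; apply.
(* Stationarity at [x nu], with [d] the derivative of the smoothed constraint sum. The conditional
   is the derivative of its positive part, left unresolved because feasibility and stationarity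
   settle the sign of [G] differently. *)
have key v e : tangent_cone (S_ps_hat X g h xstar) xstar v -> 0 < e ->
  \forall nu \near \oo, exists2 d,
    d <= \sum_(l | 0 < h l xstar) dirderiv (phi l) (x nu) v + e &
    let G := \sum_l phi l (x nu) * theta_phi l (h l (x nu)) (delta nu) - b in
    0 <= dirderiv c (x nu) v +
      (\sum_(k | 0 < g k xstar) dirderiv (vphi k) (x nu) v + e) +
      lambda * (if 0 < G then d else if G < 0 then 0 else Num.max d 0).
  move=> Tv e0.
  have [TXv gv hv] := S_ps_hat_tangent_le0 Ostar g_Bdiff h_Bdiff Tv.
  have dE := smoothed_sum_dirderiv (v := v) O_open Ostar delta_gt0
    delta_cvg x_cvg theta_vphi_approx vphi_Bdiff g_Bdiff _ e0.
  have dG := smoothed_sum_dirderiv (v := v) O_open Ostar delta_gt0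
    delta_cvg x_cvg theta_phi_approx phi_Bdiff h_Bdiff _ e0.
  have near_T : \forall nu \near \oo, tangent_cone X (x nu) v.
    by apply: filterS (near_ray v TXv) => nu; exact: tangent_cone_ray.
  near=> nu.
  have [dE' dE'P dE'le] : exists2 d, has_dirderiv
      (fun y => \sum_k vphi k y * theta_vphi k (g k y) (delta nu)) (x nu) v d &
      d <= \sum_(k | 0 < g k xstar) dirderiv (vphi k) (x nu) v + e.
    near: nu; apply: dE => k gk0.
    have kz : k \in idx_zero g xstar by rewrite inE gk0.
    split; last exact: C3.1.
    - by apply: filterS near_N => nu; exact: C1.1.
    - by apply: filterS near_N => nu; exact: (C2 _ TXv).1.
  have [d dP dle] : exists2 d, has_dirderiv
      (fun y => \sum_l phi l y * theta_phi l (h l y) (delta nu)) (x nu) v d &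
      d <= \sum_(l | 0 < h l xstar) dirderiv (phi l) (x nu) v + e.
    near: nu; apply: dG => l hl0.
    have lz : l \in idx_zero h xstar by rewrite inE hl0.
    split; last exact: C3.2.
    - by apply: filterS near_N => nu; exact: C1.2.
    - by apply: filterS near_N => nu; exact: (C2 _ TXv).2.
  exists d => //=; have Tnu : tangent_cone X (x nu) v by near: nu.
  have cP : has_dirderiv c (x nu) v (dirderiv c (x nu) v).
    exact: B_differentiable_has_dirderiv c_Bdiff (XO _ (x_X nu)).
  have dbP := has_dirderivD dP (has_dirderiv_cst (- b) (x nu) v).
  have PhiP := has_dirderivD (has_dirderivD cP dE'P) (has_dirderivM
    (has_dirderiv_cst lambda (x nu) v) (has_dirderiv_max0 dbP)).
  have := x_dstat nu v Tnu; rewrite (has_dirderivE PhiP) mul0r add0r addr0.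
  by move=> /le_trans; apply; rewrite !lerD.
(* A second point of [X] makes the Lipschitz constants nonnegative, hence [lambda] positive. It is
   found by a short step from [xstar] along a nonzero tangent direction. *)
have other_point v : tangent_cone X xstar v -> v != 0 ->
    exists2 y, X y & y != xstar.
  move=> Tv v0.
  have /(_ Xstar) ray := nbhs_singleton (polyhedron_ray X_poly Tv).
  near (0 : R)^'+ => t.
  have t0 : 0 < t by near: t; exact: nbhs_right_gt.
  exists (xstar + t *: v); first by near: t.
  by rewrite -subr_eq0 addrAC subrr add0r scaler_eq0 negb_or gt_eqF.
have Lip_vphi_ge0 y : X y -> y != xstar -> 'I_K -> 0 <= Lip_vphi.
  by move=> Xy yx k; exact: elipschitz_ge0 (vphi_Lip k) Xy Xstar yx.
have lambda_gt0 y : X y -> y != xstar -> 0 < lambda.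
  move=> Xy yx; apply: le_lt_trans lambda_gt.
  rewrite addr_ge0//; first exact: elipschitz_ge0 c_Lip Xy Xstar yx.
  (* With no index [k], the sign of [Lip_vphi] is unknown, but its coefficient vanishes. *)
  have [->|K0] := posnP K; first by rewrite mul0r.
  by rewrite mulr_ge0// (Lip_vphi_ge0 _ Xy yx (Ordinal K0)).
have [cC vphiC phiC] := C5.
(* Were the penalised constraint violated in the limit, the direction [w] of
   (C4) would make the penalty decrease at rate [lambda], which exceeds the
   largest possible increase [Lip_c + K * Lip_vphi] of the other terms. *)
have feas : \sum_(l | 0 < h l xstar) phi l xstar <= b.
  rewrite leNgt; apply/negP => infeas.
  have [||w [Tw w1 dw]] := C4 xstar => //.
  have [TXw _ _] := S_ps_hat_tangent_le0 Ostar g_Bdiff h_Bdiff Tw.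
  have w0 : w != 0.
    apply/eqP => w0; move: w1; rewrite w0 -(scale0r (0 : 'rV[R]_n)) enormZ//.
    by rewrite mul0r => /esym/eqP; rewrite oner_eq0.
  have [y Xy yx] := other_point _ TXw w0.
  have l0 := lambda_gt0 _ Xy yx.
  pose gap := lambda - (Lip_c + K%:R * Lip_vphi).
  have gap0 : 0 < gap by rewrite subr_gt0.
  (* Stationarity will read [0 <= Lip_c + K%:R * Lip_vphi + e + lambda * (-1 + 2 * e)], that is
     [0 <= e * (2 * lambda + 1) - gap]; this choice makes the right side [- gap / 2]. *)
  pose e := gap / (2 * lambda + 1) / 2.
  have den0 : 0 < 2 * lambda + 1 by lra.
  have e0 : 0 < e by rewrite /e divr_gt0// divr_gt0.
  near \oo => nu.
  have [d dle] : exists2 d,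
    d <= \sum_(l | 0 < h l xstar) dirderiv (phi l) (x nu) w + e &
    let G := \sum_l phi l (x nu) * theta_phi l (h l (x nu)) (delta nu) - b in
    0 <= dirderiv c (x nu) w +
      (\sum_(k | 0 < g k xstar) dirderiv (vphi k) (x nu) w + e) +
      lambda * (if 0 < G then d else if G < 0 then 0 else Num.max d 0).
    by near: nu; exact: key.
  have G0 : b < \sum_l phi l (x nu) * theta_phi l (h l (x nu)) (delta nu).
    by near: nu; exact: (cvgr_gt _ penalty_cvg).
  rewrite /= subr_gt0 G0.
  have phile : \sum_(l | 0 < h l xstar) dirderiv (phi l) (x nu) w <=
      \sum_(l | 0 < h l xstar) (dirderiv (phi l) xstar w) + e.
    by near: nu; exact: Clarke_regular_sum_near.
  have ray : \forall t \near 0^'+, X (x nu + t *: w).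
    by near: nu; exact: near_ray.
  have cle : dirderiv c (x nu) w <= Lip_c.
    rewrite -[leRHS]mulr1 -w1.
    apply: (elipschitz_dirderiv_le c_Lip _ ray) => //.
    exact: B_differentiable_has_dirderiv c_Bdiff (XO _ (x_X nu)).
  have vphile : \sum_(k | 0 < g k xstar) dirderiv (vphi k) (x nu) w
      <= K%:R * Lip_vphi.
    (* Indices outside the positive group count as 0, which is at most [Lip_vphi], so all [K] of
       them may be summed. *)
    rewrite big_mkcond mulr_natl -[X in _ *+ X]card_ord -sumr_const.
    rewrite ler_sum// => k _.
    case: ifP => [_|_]; last exact: Lip_vphi_ge0 Xy yx k.
    rewrite -[leRHS]mulr1 -w1.
    apply: (elipschitz_dirderiv_le (vphi_Lip k) _ ray) => //.
    exact: B_differentiable_has_dirderiv (vphi_Bdiff k) (XO _ (x_X nu)).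
  apply/negP; rewrite -ltNge.
  have ld : lambda * d <= lambda * (-1 + 2 * e).
    rewrite ler_pM2l//; move: dw.
    rewrite (eq_bigl (fun l => 0 < h l xstar))//; lra.
  have ee : e * (2 * lambda + 1) = gap / 2 by rewrite /e; field; lra.
  rewrite /gap in ee gap0; lra.
split.
  by split=> //; rewrite (eq_bigl (fun l => 0 < h l xstar)).
move=> v Tv.
have Thv : tangent_cone (S_ps_hat X g h xstar) xstar v.
  by apply: tangent_cone_sub Tv => y [].
have [TXv _ _] := S_ps_hat_tangent_le0 Ostar g_Bdiff h_Bdiff Thv.
have [->|v0] := eqVneq v 0.
  by rewrite (has_dirderivE (has_dirderiv0 _ _)).
have objP : has_dirderiv (fun y => c y + \sum_(k in idx_pos g xstar) vphi k y)
    xstar v (dirderiv c xstar v +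
      \sum_(k | 0 < g k xstar) dirderiv (vphi k) xstar v).
  apply: has_dirderivD.
    exact: B_differentiable_has_dirderiv c_Bdiff Ostar.
  apply: has_dirderiv_sum => k _.
  exact: B_differentiable_has_dirderiv (vphi_Bdiff k) Ostar.
rewrite (has_dirderivE objP).
have [y Xy yx] := other_point _ TXv v0.
have l0 := lambda_gt0 _ Xy yx.
apply/ler_addgt0Pr => e e0.
(* Error budget: one [e1] from [c], two from the [vphi] terms (smoothing and Clarke regularity), and
   [2 * lambda * e1] from the penalty. *)
pose e1 := e / (3 + 2 * lambda).
have den0 : 0 < 3 + 2 * lambda by lra.
have e10 : 0 < e1 by rewrite divr_gt0.
have near_slack : \forall nu \near \oo,
    \sum_(l | 0 < h l xstar) phi l xstar < b ->
    \sum_l phi l (x nu) * theta_phi l (h l (x nu)) (delta nu) < b.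
  have [slack|tight] := ltP (\sum_(l | 0 < h l xstar) phi l xstar) b.
    by apply: filterS (cvgr_lt _ penalty_cvg _ slack).
  exact: nearW.
near \oo => nu.
have [d dle] : exists2 d,
  d <= \sum_(l | 0 < h l xstar) dirderiv (phi l) (x nu) v + e1 &
  let G := \sum_l phi l (x nu) * theta_phi l (h l (x nu)) (delta nu) - b in
  0 <= dirderiv c (x nu) v +
    (\sum_(k | 0 < g k xstar) dirderiv (vphi k) (x nu) v + e1) +
    lambda * (if 0 < G then d else if G < 0 then 0 else Num.max d 0).
  by near: nu; exact: key.
move=> /=; set G := (_ - b) => stat.
have phile : \sum_(l | 0 < h l xstar) dirderiv (phi l) (x nu) v <=
    \sum_(l | 0 < h l xstar) (dirderiv (phi l) xstar v) + e1.
  by near: nu; exact: Clarke_regular_sum_near.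
have vphile : \sum_(k | 0 < g k xstar) dirderiv (vphi k) (x nu) v <=
    \sum_(k | 0 < g k xstar) (dirderiv (vphi k) xstar v) + e1.
  by near: nu; exact: Clarke_regular_sum_near.
have cle : dirderiv c (x nu) v < dirderiv c xstar v + e1.
  by near: nu; exact: Clarke_regular_near.
have pen : (if 0 < G then d else if G < 0 then 0 else Num.max d 0) <= 2 * e1.
  have e2 : 0 <= 2 * e1 by rewrite mulr_ge0// ltW.
  (* A slack limit constraint makes the penalty locally zero at [x nu]. If it is tight, [xstar]
     maximizes the active sum over [S_ps], so its derivative along [v] is nonpositive and [d] is at
     most [2 * e1], whatever the sign of [G]. *)
  have [slack|tight] := ltP (\sum_(l | 0 < h l xstar) phi l xstar) b.
    have G0 : G < 0.
      by rewrite subr_lt0; move: slack; near: nu.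
    by rewrite (lt_gtF G0) G0.
  have dphi : \sum_(l | 0 < h l xstar) dirderiv (phi l) xstar v <= 0.
    pose f y := \sum_(l | 0 < h l xstar) phi l y.
    apply: (tangent_cone_dirderiv_le0 (f := f) Tv).
    - by apply: locally_lipschitz_at_sum => l _; exact: (phi_Bdiff l _ Ostar).1.
    - apply: has_dirderiv_sum => l _.
      exact: B_differentiable_has_dirderiv (phi_Bdiff l) Ostar.
    - by move=> y' [_ le]; apply: le_trans tight.
  have d2 : d <= 2 * e1 by lra.
  by do 2?case: ifP => // _; rewrite ge_max d2.
have lpen := ler_wpM2l (ltW l0) pen.
have ee : e1 * (3 + 2 * lambda) = e by rewrite /e1; field; lra.
rewrite -/G in stat; move: stat lpen; set pn := (if _ then _ else _).
by move=> stat lpen; clear -stat lpen cle vphile ee; lra.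
Unshelve. all: by end_near. Qed.
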